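(* Let $n\ge 3$ and let $H=\langle a_1,\ldots,a_n\rangle$ be a numerical semigroup minimally generated by the $n$ positive integers $a_1,\ldots,a_n$. Suppose that there are integers $h\ge 0$ and $\alpha>0$ with $$\mathrm{PF}(H)=\{h+\alpha,\,h+2\alpha,\ldots,h+(n-1)\alpha\},$$ and that $h$ has a unique factorization $h=q_1a_1+\cdots+q_na_n$ (with $q_i\in\mathbb N$) in $H$. Then, after a suitable permutation of $a_1,\ldots,a_n$ (with $q_1,\ldots,q_n$ and the variables $X_1,\ldots,X_n$ permuted accordingly), there exist positive integers $r_1,\ldots,r_n$ such that $$(q_i+1)a_i+\alpha=r_{i+1}a_{i+1}\qquad\text{for all }1\le i\le n,$$ where indices are taken modulo $n$. Consequently, for any field $k$, the defining ideal of $k[H]$ is $$I_H=\mathrm I_2\begin{pmatrix}X_1^{q_1+1}&X_2^{q_2+1}&\cdots&X_n^{q_n+1}\\ X_2^{r_2}&X_3^{r_3}&\cdots&X_1^{r_1}\end{pmatrix}.$$ In particular, the graded minimal $S$-free resolution of $k[H]$ is given by the Eagon--Northcott complex of this matrix.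
   Context: $\mathbb N=\{0,1,2,\ldots\}$. A numerical semigroup is a submonoid $H$ of $\mathbb N$ (containing $0$) with finite complement in $\mathbb N$; $\langle a_1,\ldots,a_n\rangle$ is the set of all $\mathbb N$-linear combinations of $a_1,\ldots,a_n$. The set of pseudo-Frobenius numbers is $\mathrm{PF}(H)=\{f\in\mathbb Z\setminus H : f+s\in H \text{ for every } 0<s\in H\}$. A factorization of $h$ in $H=\langle a_1,\ldots,a_n\rangle$ is a tuple $(q_1,\ldots,q_n)\in\mathbb N^n$ with $h=\sum_i q_ia_i$; $h$ has a unique factorization if there is exactly one such tuple. Let $k$ be a field, $k[H]=k[t^{a_1},\ldots,t^{a_n}]\subseteq k[t]$, and $S=k[X_1,\ldots,X_n]$ graded by $\deg X_i=a_i$. The defining ideal $I_H$ is the kernel of the graded $k$-algebra map $\varphi:S\to k[H]$, $X_i\mapsto t^{a_i}$. For a matrix $M$ with entries in $S$, $\mathrm I_2(M)$ is the ideal generated by the $2\times 2$ minors of $M$. The Eagon--Northcott complex of a $2\times n$ matrix over $S$, viewed as a map $\phi:F=S^n\to G=S^2$, is the complex $0\to \bigwedge^{n}F\otimes(\mathrm{Sym}_{n-2}G)^*\to\cdots\to\bigwedge^{3}F\otimes(\mathrm{Sym}_1G)^*\to\bigwedge^2F\to S$. The last map is $\bigwedge^2\phi$ (with $\bigwedge^2 G\cong S$). The other maps are $e_{i_1}\wedge\cdots\wedge e_{i_p}\otimes u\mapsto\sum_{s}(-1)^{s-1}e_{i_1}\wedge\cdots\widehat{e_{i_s}}\cdots\wedge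 e_{i_p}\otimes(\phi(e_{i_s})\cdot u)$, where $g\cdot u$ is the contraction $(g\cdot u)(x)=u(gx)$. The complex is graded so that all maps are homogeneous of degree $0$. *)

(* Defs.v *)
From HB Require Import structures.
From mathcomp Require Import all_boot all_order all_algebra all_fingroup.
From mathcomp Require Import mpoly.

Set Implicit Arguments.
Unset Strict Implicit.
Unset Printing Implicit Defensive.

Import GRing.Theory.
Local Open Scope ring_scope.

Section Semigroups.

Definition numerical_semigroup (H : nat -> Prop) : Prop :=
  [/\ H 0%N, (forall x y, H x -> H y -> H (x + y)%N)
    & exists gaps : seq nat, forall m, ~ H m -> m \in gaps].

Variables (n : nat) (a : 'I_n -> nat).

Definition factorization (h : nat) (q : {ffun 'I_n -> nat}) : Prop :=
  h = (\sum_i q i * a i)%N.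

Definition unique_factorization (h : nat) (q : {ffun 'I_n -> nat}) : Prop :=
  factorization h q /\ forall q', factorization h q' -> q' = q.

Definition generated_by (A : {set 'I_n}) (h : nat) : Prop :=
  exists q : 'I_n -> nat, h = (\sum_(i in A) q i * a i)%N.

Definition semigroup : nat -> Prop := generated_by [set: 'I_n].

(* No proper subfamily generates the same semigroup; in particular the a i are
   pairwise distinct. *)
Definition minimally_generating : Prop :=
  forall A : {set 'I_n}, A \proper [set: 'I_n] ->
    ~ (forall h, generated_by A h <-> semigroup h).

End Semigroups.

Definition mem_int (H : nat -> Prop) (f : int) : Prop :=
  exists2 m : nat, H m & f = m%:Z.

Definition pseudo_frobenius (H : nat -> Prop) (f : int) : Prop :=
  ~ mem_int H f /\ forall s : nat, (0 < s)%N -> H s -> mem_int H (f + s%:Z).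

Definition ideal_gen (R : comNzRingType) (I : finType) (g : I -> R) (x : R) :
    Prop :=
  exists c : I -> R, x = \sum_i c i * g i.

Section Minors.

Variables (R : comNzRingType) (n : nat) (M : 'M[R]_(2, n)).

Definition minor2 (i j : 'I_n) : R :=
  \det (colsub (fun s : 'I_2 => if s == 0 then i else j) M).

(* The pairs with j <= i contribute only 0 or the opposite of a minor. *)
Definition I2 : R -> Prop :=
  ideal_gen (fun ij : 'I_n * 'I_n => minor2 ij.1 ij.2).

End Minors.

Section EagonNorthcott.

(* Free modules are written in coordinates, {ffun B -> R} being the free module
   on the finite basis B.  With F = R^n, G = R^2 and y_0, y_1 the basis of G,
   the module in homological degree m.+1 is
     /\^(m.+2) F (x) (Sym_m G)^*,
   with basis the pairs (A, l): A stands for e_(i_1) /\ ... /\ e_(i_(m.+2)),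
   where i_1 < ... < i_(m.+2) are the elements of A, and l for the linear form
   u_l dual to the monomial y_0^(m - l) y_1^l.  The basis is empty, hence the
   module is 0, in homological degrees >= n. *)
Definition EN_basis (n p : nat) : finType :=
  match p with
  | 0 => unit : finType
  | m.+1 => ({A : {set 'I_n} | #|A| == m.+2} * 'I_m.+1)%type : finType
  end.

Variables (R : comNzRingType) (n : nat) (M : 'M[R]_(2, n)).

(* The coefficient at the basis element c of the image of the basis element b.
   The number of j in A with j < i is s - 1 when i = i_s.  The last factor is
   (phi(e_i) . u_l)(y_0^(m - l') y_1^l') = u_l (phi(e_i) y_0^(m - l') y_1^l'),
   where phi(e_i) = M 0 i * y_0 + M 1 i * y_1, l = b.2 and l' = c.2.  For p = 0,
   the sum has one term, the minor on the two columns in A. *)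
Definition EN_coef (p : nat) : EN_basis n p.+1 -> EN_basis n p -> R :=
  match p with
  | 0 => fun b _ =>
      \sum_(i in val b.1) \sum_(j in val b.1 | (i < j)%N) minor2 M i j
  | m.+1 => fun b c =>
      \sum_(i in val b.1 | val c.1 == val b.1 :\ i)
        (-1) ^+ #|[set j in val b.1 | (j < i)%N]| *
        (M 0 i *+ (b.2 == c.2 :> nat) + M 1 i *+ (b.2 == c.2.+1 :> nat))
  end.

Definition EN_diff (p : nat) (v : {ffun EN_basis n p.+1 -> R}) :
    {ffun EN_basis n p -> R} :=
  [ffun c => \sum_b v b * EN_coef b c].

(* The grading for which the complex of a matrix with deg (M 0 i) = d i and
   deg (M 1 i) = d i + alpha is homogeneous, the generator of R in homological
   degree 0 having degree 0: e_i has degree d i, y_0 has degree 0, y_1 has degree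
   - alpha, and identifying /\^2 G with R adds alpha. *)
Definition EN_deg (d : 'I_n -> nat) (alpha p : nat) : EN_basis n p -> nat :=
  match p with
  | 0 => fun _ => 0%N
  | m.+1 => fun b => (\sum_(i in val b.1) d i + b.2.+1 * alpha)%N
  end.

End EagonNorthcott.

Section SemigroupRing.

Variables (k : fieldType) (n : nat) (a : 'I_n -> nat).

Local Notation S := {mpoly k[n]}.

(* k[t^(a_1), ..., t^(a_n)], the least k-subalgebra of k[t] containing the
   t^(a_i). *)
Definition semigroup_ring (f : {poly k}) : Prop :=
  forall P : {poly k} -> Prop,
    (forall c : k, P c%:P) ->
    (forall x y, P x -> P y -> P (x + y)) ->
    (forall x y, P x -> P y -> P (x * y)) ->
    (forall i, P 'X^(a i)) ->
    P f.

Definition phi (x : S) : {poly k} := mmap (@polyC k) (fun i => 'X^(a i)) x.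

Definition defining_ideal (x : S) : Prop := phi x = 0.

Definition wdeg (m : 'X_{1..n}) : nat := (\sum_i m i * a i)%N.

Definition max_ideal : S -> Prop := ideal_gen (fun i : 'I_n => 'X_i : S).

(* v is homogeneous of degree e in the free module with basis B, whose basis
   element b has degree dg b. *)
Definition homogeneous (B : finType) (dg : B -> nat) (e : nat)
    (v : {ffun B -> S}) : Prop :=
  forall b m, m \in msupp (v b) -> (wdeg m + dg b)%N = e.

(* ... -> F_2 -> F_1 -> F_0 -> k[H] -> 0 with F_p = {ffun B p -> S}, graded by
   dg p; k[H] is an S-module through phi. *)
Record graded_minimal_free_resolution
    (B : nat -> finType) (dg : forall p, B p -> nat)
    (d : forall p, {ffun B p.+1 -> S} -> {ffun B p -> S})
    (eps : {ffun B 0%N -> S} -> {poly k}) : Prop := {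
  gmfr_diff_linear : forall p (x : S) (v w : {ffun B p.+1 -> S}),
    d p [ffun b => x * v b + w b] = [ffun c => x * d p v c + d p w c];
  gmfr_aug_linear : forall (x : S) (v w : {ffun B 0%N -> S}),
    eps [ffun b => x * v b + w b] = phi x * eps v + eps w;
  gmfr_diff_homogeneous : forall p e (v : {ffun B p.+1 -> S}),
    homogeneous (dg p.+1) e v -> homogeneous (dg p) e (d p v);
  gmfr_aug_homogeneous : forall e (v : {ffun B 0%N -> S}),
    homogeneous (dg 0%N) e v -> exists c : k, eps v = c *: 'X^e;
  gmfr_aug_onto : forall f,
    semigroup_ring f <-> exists v, eps v = f;
  gmfr_exact0 : forall v,
    eps v = 0 <-> exists w, v = d 0%N w;
  gmfr_exact : forall p v,
    d p v = [ffun=> 0] <-> exists w, v = d p.+1 w;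
  gmfr_minimal : forall p v c, max_ideal (d p v c)
}.

Definition cyclic_matrix (q r : 'I_n -> nat) : 'M[S]_(2, n) :=
  \matrix_(s < 2, i < n)
    if s == 0 then 'X_i ^+ (q i).+1 else 'X_(ordS i) ^+ r (ordS i).

End SemigroupRing.

Arguments EN_deg {n} d alpha p _.
Arguments EN_diff {R n} M p v.

(* Main.v *)
(* Since PF(H) = {f_1, ..., f_(n-1)} with f_j = h + j alpha, an integer z lies
   outside H iff some f_j - z lies in H.  Hence s + alpha is in H as soon as s
   is in H and h - s is not; as h has a unique factorization, this applies to
   s = (q_i + 1) a_i, and (q_i + 1) a_i + alpha = sum_l w_il a_l.  If in a
   nonempty set C of indices every l has some i in C with w_il > 0, then summing
   over C puts h + #|C| alpha in H, so C contains every index.  This forces the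
   graph i -> l iff w_il > 0 to be a single n-cycle, which gives the r_i.

   For I_H = I_2(M), two monomials X^u, X^v of the same degree s are congruent
   modulo the minors by induction on s.  If s - alpha is in H, each of them is
   divisible by an entry of the second row; exchanging this entry for the one
   above it lowers the degree by alpha, and the inverse exchange respects
   congruence.  Otherwise h + n alpha - s is in H, and u = v because
   h + n alpha = sum_i (r_i - 1) a_i has no other factorization.

   Let d0 and d1 be the Koszul differentials of the two rows of M, whose entries
   are powers of distinct variables, so that d0 and d1 are exact in positive
   degrees.  The Eagon-Northcott complex is made of truncated sequences (v_l) of
   Koszul chains, with differential d0 v_l + d1 v_(l+1).  A cycle can be
   prolonged on the right by solving d1 v_(l+1) = - d0 v_l; this stops because
   the degree drops by alpha at each step.  Then v_l = d0 w_l + d1 w_(l+1) is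
   solved from right to left. *)
Require Import Defs.
From HB Require Import structures.
From mathcomp Require Import all_boot all_order all_algebra all_fingroup.
From mathcomp Require Import mpoly zify ring.
From Stdlib Require Import Classical.

Set Implicit Arguments.
Unset Strict Implicit.
Unset Printing Implicit Defensive.

Import GRing.Theory.
Local Open Scope ring_scope.

(** * Numerical semigroups and pseudo-Frobenius numbers *)

Lemma semigroupE (n : nat) (a : 'I_n -> nat) (m : nat) :
  semigroup a m <-> exists q : 'I_n -> nat, m = (\sum_i q i * a i)%N.
Proof.
by split=> -[q ->]; exists q; apply: eq_bigl => i; rewrite in_setT.
Qed.

(** While [z] is not pseudo-Frobenius, adding some positive element of [H] keeps it outside [H],
    hence below the bound [N] past which everything is in [H]; so the climb ends. *)
Lemma pseudo_frobenius_above (H : nat -> Prop) (z : int) :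
  numerical_semigroup H -> ~ mem_int H z ->
  exists2 f, pseudo_frobenius H f & mem_int H (f - z).
Proof.
case=> H0 HD [gaps gapsP].
have [N NP] : exists N, forall m, (N <= m)%N -> H m.
  exists (\max_(g <- gaps) g).+1 => m ltNm; apply: NNPP => /gapsP mgaps.
  by move: ltNm; rewrite ltnNge (leq_bigmax_seq _ mgaps).
have [M ltM] := ubnP `|N%:Z - z|%N.
elim: M z ltM => // M IH z ltM zH.
have [zPF|] := classic (pseudo_frobenius H z).
  by exists z => //; exists 0%N => //; rewrite subrr.
move=> nPF.
have [s s_gt0 [Hs nzs]] : exists2 s, (0 < s)%N & H s /\ ~ mem_int H (z + s%:Z).
  apply: NNPP => nex; apply: nPF; split=> // s s_gt0 Hs.
  by apply: NNPP => nzs; apply: nex; exists s.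
have zs_lt : (z + s%:Z < N%:Z)%R.
  rewrite Order.TotalTheory.ltNge.
  apply/negP => leN; apply: nzs; exists (absz (z + s%:Z)); last by lia.
  by apply: NP; lia.
have [|f fPF [m Hm fE]] := IH (z + s%:Z) _ nzs; first by lia.
by exists f => //; exists (m + s)%N; [apply: HD | lia].
Qed.

(** * Shifts by the common difference of the pseudo-Frobenius numbers *)

Section ArithmeticPseudoFrobenius.

Variables (n h alpha : nat) (H : nat -> Prop).
Hypothesis Hsg : numerical_semigroup H.
Hypothesis pf_ap : forall f : int, pseudo_frobenius H f <->
  exists2 j : nat, (1 <= j <= n.-1)%N & f = h%:Z + j%:Z * alpha%:Z.

Lemma ap_notin j : (1 <= j <= n.-1)%N -> ~ H (h + j * alpha)%N.
Proof.
move=> jn Hj; have [nin _] : pseudo_frobenius H (h%:Z + j%:Z * alpha%:Z).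
  by apply/pf_ap; exists j.
by apply: nin; exists (h + j * alpha)%N => //; lia.
Qed.

(** If [s + alpha] were a gap, some [h + j * alpha - (s + alpha)] would lie in [H]. For [j = 1] this
    is [h - s], which is excluded; a larger [j] would put [h + (j - 1) * alpha] in [H]. *)
Lemma add_step_mem s :
  H s -> (forall y, H y -> (s + y)%N <> h) -> H (s + alpha)%N.
Proof.
move=> Hs nh; apply: NNPP => nHs.
have [|f /pf_ap[j /andP[j1 jn] ->] [m Hm fE]] :=
  pseudo_frobenius_above (z := (s + alpha)%N%:Z) Hsg.
  by case=> m Hm smE; apply: nHs; suff ->: (s + alpha)%N = m by []; lia.
have [_ HD _] := Hsg.
have smE : (s + m = h + j.-1 * alpha)%N by nia.
have [j_eq1|j_neq1] := eqVneq j 1%N; first by apply: (nh m Hm); subst j; lia.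
by apply: (@ap_notin j.-1); [lia | rewrite -smE; apply: HD].
Qed.

(** If the integer [s - alpha], possibly negative, is outside [H], then some
    [h + (j + 1) * alpha - s] is in [H]. So [h + (j + 1) * alpha] is in [H], which forces
    [j = n - 1]. *)
Lemma sub_step_mem s : H s ->
  (exists2 y, H y & (y + alpha)%N = s) \/
  (exists2 y, H y & (s + y)%N = (h + n * alpha)%N).
Proof.
move=> Hs; have [|nH] := classic (exists2 y, H y & (y + alpha)%N = s).
  by left.
right; have [|f /pf_ap[j /andP[j1 jn] ->] [m Hm fE]] :=
  pseudo_frobenius_above (z := s%:Z - alpha%:Z) Hsg.
  by case=> m Hm smE; apply: nH; exists m => //; lia.
have [_ HD _] := Hsg.
have smE : (s + m = h + j.+1 * alpha)%N by nia.
have [jE|j_neq] := eqVneq j n.-1.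
  by exists m => //; rewrite smE; congr (_ + _ * _)%N; lia.
by case: (@ap_notin j.+1); [lia | rewrite -smE; apply: HD].
Qed.

End ArithmeticPseudoFrobenius.

(** * Relations among the generators as a graph on the indices *)

Section SuccessorGraph.

Variables (n h alpha : nat) (a : 'I_n -> nat) (q : 'I_n -> nat).
Variable w : 'I_n -> 'I_n -> nat.
Hypothesis n_gt0 : (0 < n)%N.
Hypothesis a_gt0 : forall i, (0 < a i)%N.
Hypothesis hE : h = (\sum_i q i * a i)%N.
Hypothesis notin : forall j, (1 <= j <= n.-1)%N ->
  ~ semigroup a (h + j * alpha)%N.
Hypothesis wE : forall i, ((q i + 1) * a i + alpha = \sum_l w i l * a l)%N.

(* Summing the relations wE over C and cancelling one a_l for every l in C
   gives h + #|C| * alpha in the semigroup. *)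
Lemma pred_closed_full (C : {set 'I_n}) :
  C != set0 -> (forall l, l \in C -> exists2 y, y \in C & (0 < w y l)%N) ->
  C = [set: 'I_n].
Proof.
move=> C0 predC; apply/eqP; rewrite eqEcard subsetT /= cardsT card_ord.
rewrite leqNgt; apply/negP => ltCn.
apply: (@notin #|C|); first by rewrite card_gt0 C0 /=; lia.
pose W l := (\sum_(y in C) w y l)%N.
have W_gt0 l : l \in C -> (l \in C <= W l)%N.
  move=> lC; have [y yC wyl] := predC l lC; rewrite lC /W (bigD1 y) //=.
  by rewrite (leq_trans wyl) // leq_addr.
apply/semigroupE; exists (fun l => (W l - (l \in C)) + (l \notin C) * q l)%N.
have sumW : (\sum_(y in C) ((q y + 1) * a y + alpha) = \sum_l W l * a l)%N.
  under eq_bigr => y _ do rewrite wE.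
  by rewrite exchange_big /=; apply: eq_bigr => l _; rewrite big_distrl.
apply/eqP; rewrite -(eqn_add2r (\sum_(y in C) a y)%N); apply/eqP.
have -> : (\sum_(y in C) a y = \sum_l (l \in C) * a l)%N.
  by rewrite big_mkcond; apply: eq_bigr => l _; case: ifP; rewrite ?mul1n.
rewrite -big_split /=.
transitivity (\sum_l (W l * a l + (l \notin C) * (q l * a l)))%N; last first.
  apply: eq_bigr => l _; have := W_gt0 l.
  by case: (l \in C) => // Wl; [have := Wl isT; nia | rewrite /=; lia].
rewrite big_split /= -sumW.
have -> : (\sum_l (l \notin C) * (q l * a l) =
    \sum_(l | l \notin C) q l * a l)%N.
  by rewrite [RHS]big_mkcond; apply: eq_bigr => l _; case: ifP; rewrite ?mul1n.
have -> : (\sum_l (l \in C) * a l = \sum_(l in C) a l)%N.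
  by rewrite [RHS]big_mkcond; apply: eq_bigr => l _; case: ifP; rewrite ?mul1n.
have -> : (\sum_(y in C) ((q y + 1) * a y + alpha) =
  \sum_(y in C) q y * a y + \sum_(y in C) a y + #|C| * alpha)%N.
  rewrite -sum_nat_const -!big_split; apply: eq_bigr => y _ /=.
  by rewrite mulnDl mul1n.
rewrite hE (bigID (mem C)) /= -!addnA; congr addn.
by rewrite addnC addnAC addnC.
Qed.

Lemma row_neq0 i : exists l, (0 < w i l)%N.
Proof.
apply/existsP; apply: contraT; rewrite negb_exists => /forallP w0.
have := wE i; rewrite big1 => [|l _]; first by have := a_gt0 i; nia.
by have := w0 l; rewrite -eqn0Ngt => /eqP ->.
Qed.

(** Either [g] maps [C] onto itself and supplies the predecessors asked for in [pred_closed_full],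
    or [g @: C] is a smaller nonempty invariant set, hence everything by induction. *)
Lemma choice_invariant_full (g : 'I_n -> 'I_n) (C : {set 'I_n}) :
  (forall i, 0 < w i (g i))%N -> C != set0 -> g @: C \subset C ->
  C = [set: 'I_n].
Proof.
move=> gP; have [N] := ubnP #|C|; elim: N C => // N IH C ltCN C0 gC.
have [gCE|gCE] := eqVneq (g @: C) C.
  apply: pred_closed_full => // l; rewrite -{1}gCE => /imsetP[y yC ->].
  by exists y.
have ltgC : g @: C \proper C by rewrite properEneq gCE.
have gCT : g @: C = [set: 'I_n].
  apply: IH; last exact: imsetS.
    by apply: leq_trans (proper_card ltgC) _.
  by case/set0Pn: C0 => y yC; apply/set0Pn; exists (g y); apply: imset_f.
by apply/eqP; rewrite -subTset -gCT proper_sub.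
Qed.

(** The image of [g] is invariant, hence full, and a surjection of a finite set is injective. *)
Lemma choice_inj (g : 'I_n -> 'I_n) :
  (forall i, 0 < w i (g i))%N -> injective g.
Proof.
move=> gP; have gT : g @: [set: 'I_n] = [set: 'I_n].
  apply: (choice_invariant_full gP); last exact: imsetS.
  apply/set0Pn; exists (g (Ordinal n_gt0)); exact: imset_f.
suff /imset_injP gI : #|g @: [set: 'I_n]| == #|[set: 'I_n]|.
  by move=> x y; apply: gI; rewrite inE.
by rewrite gT.
Qed.

Lemma successor_cycle : exists s : 'S_n,
  forall i l, (0 < w (s i) l)%N = (l == s (ordS i)).
Proof.
pose g i := xchoose (row_neq0 i).
have gP i : (0 < w i (g i))%N by exact: (xchooseP (row_neq0 i)).
have g_inj := choice_inj gP.
have w_supp i l : (0 < w i l)%N = (l == g i).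
  apply/idP/eqP => [wil|->//]; apply: contraTeq isT => l_neq.
  have lT : l \in codom g by exact: inj_card_onto g_inj (leqnn _) l.
  (* Redirecting [i] to a second successor [l] gives another injective choice; as [l] is already
     [g j] for some [j], this forces [j = i]. *)
  pose g' := [fun j => g j with i |-> l].
  have g'_inj : injective g'.
    by apply: choice_inj => j /=; case: eqP => [->|].
  have /codomP[j lj] := lT.
  have ij : i = j; last by move: l_neq; rewrite lj ij eqxx.
  by apply: g'_inj; rewrite /= eqxx; case: eqP => // _; rewrite lj.
(* The orbit of [x0] is invariant, hence full: [g] is a single [n]-cycle, and its iterates at [x0]
   enumerate the indices. *)
pose x0 := Ordinal n_gt0.
have conT y : fconnect g x0 y.
  suff: [set z | fconnect g x0 z] = [set: 'I_n].
    by move/setP/(_ y); rewrite !inE.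
  apply: (choice_invariant_full gP).
    by apply/set0Pn; exists x0; rewrite inE.
  apply/subsetP => z /imsetP[y0]; rewrite !inE => con ->.
  by apply: connect_trans con (fconnect1 _ _).
have ordx : fingraph.order g x0 = n.
  rewrite /fingraph.order -[RHS]card_ord; apply: eq_card => y.
  by rewrite inE conT.
have s_inj : injective (fun i : 'I_n => iter i g x0).
  move=> i j ij; apply/val_inj/eqP.
  rewrite -(nth_uniq x0 _ _ (orbit_uniq g x0)) ?size_orbit ?ordx ?ltn_ord //.
  by rewrite /fingraph.orbit ordx !nth_traject ?ltn_ord // ij.
exists (perm s_inj) => i l; rewrite w_supp !permE /=; congr (_ == _).
have [ltin|lein] := ltnP i.+1 n; first by rewrite modn_small.
have inE : i.+1 = n by apply/eqP; rewrite eqn_leq ltn_ord.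
by rewrite -iterS inE modnn; have := iter_order g_inj x0; rewrite ordx.
Qed.

End SuccessorGraph.

(** * Koszul differentials *)

Section Koszul.

Variables (R : comNzRingType) (n : nat).

Local Notation chain := {ffun {set 'I_n} -> R}.
Implicit Types (f g : 'I_n -> R) (z w : chain) (A B : {set 'I_n}).

Definition ksign (i : 'I_n) (A : {set 'I_n}) : R :=
  (-1) ^+ #|[set j in A | (j < i)%N]|.

(** Contraction by [f], written coefficientwise. All exterior powers share one module of chains, and
    [chain_deg] singles out a degree, so that no type depends on it. *)
Definition koszul f z : chain :=
  [ffun A : {set 'I_n} => \sum_(i | i \notin A) ksign i A * f i * z (i |: A)].

Definition chain_deg p z := forall A, #|A| != p -> z A = 0.

Lemma ksignU1 i j A : i \notin A ->
  ksign j (i |: A) = if (i < j)%N then - ksign j A else ksign j A.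
Proof.
move=> iA; rewrite /ksign; case: ifP => ij.
  have -> : [set l in i |: A | (l < j)%N] = i |: [set l in A | (l < j)%N].
    by apply/setP => l; rewrite !inE; case: eqP => // ->; rewrite ij.
  by rewrite cardsU1 !inE (negbTE iA) /= add1n exprS mulN1r.
have -> // : [set l in i |: A | (l < j)%N] = [set l in A | (l < j)%N].
by apply/setP => l; rewrite !inE; case: eqP => // ->; rewrite ij !andbF.
Qed.

Lemma ksign_sqr i A : ksign i A * ksign i A = 1.
Proof. by rewrite /ksign -expr2 sqrr_sign. Qed.

Lemma koszulB f : {morph koszul f : z w / z - w}.
Proof.
move=> z w; apply/ffunP => A; rewrite !ffunE -sumrB.
by apply: eq_bigr => i _; rewrite !ffunE mulrBr.
Qed.

Lemma koszul0 f : koszul f 0 = 0.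
Proof. by rewrite -[in LHS](subrr 0) koszulB subrr. Qed.

Lemma koszulN f : {morph koszul f : z / - z}.
Proof. by move=> z; rewrite -[- z]add0r koszulB koszul0 add0r. Qed.

Lemma koszulD f : {morph koszul f : z w / z + w}.
Proof. by move=> z w; rewrite -{1}[w]opprK koszulB koszulN opprK. Qed.

Lemma koszul_deg f p z : chain_deg p.+1 z -> chain_deg p (koszul f z).
Proof.
move=> zp A pA; rewrite ffunE big1 // => i iA.
by rewrite zp ?mulr0 // cardsU1 iA.
Qed.

(** Adding [i] and [j] in the two orders gives opposite signs, so only 2 x 2 minors of the rows [f]
    and [g] remain. At [set0] this is the last map of the Eagon-Northcott complex. *)
Lemma koszul_koszul f g z A :
  koszul f (koszul g z) A =
  - \sum_(i | i \notin A) \sum_(j | (j \notin A) && (i < j)%N)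
      ksign i A * ksign j A * (f i * g j - f j * g i) * z (j |: (i |: A)).
Proof.
pose F i j := ksign i A * ksign j (i |: A) * (f i * g j) * z (j |: (i |: A)).
transitivity (\sum_(i | i \notin A)
    (\sum_(j | (j \notin A) && (i < j)%N) F i j
     + \sum_(j | (j \notin A) && (j < i)%N) F i j)).
  rewrite ffunE; apply: eq_bigr => i iA; rewrite ffunE big_distrr /=.
  rewrite (bigID (fun j : 'I_n => (i < j)%N)) /=; congr (_ + _).
    apply: eq_big => [j|j _]; last by rewrite /F; ring.
    rewrite !inE negb_or -val_eqE /=.
    by case: (ltngtP i j) => ij; rewrite ?andbF ?andbT.
  apply: eq_big => [j|j _]; last by rewrite /F; ring.
  rewrite !inE negb_or -val_eqE /=.
  by case: (ltngtP i j) => ij; rewrite ?andbF ?andbT.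
rewrite big_split /=.
rewrite [X in _ + X](exchange_big_dep (fun i => i \notin A)) /=; last first.
  by move=> i j _ /andP[].
rewrite -big_split -sumrN /=; apply: eq_bigr => i iA.
rewrite iA /= -big_split -sumrN /=; apply: eq_bigr => j /andP[jA ij].
rewrite /F !ksignU1 // ij ltnNge (ltnW ij) /= (setUCA [set j]); ring.
Qed.

Lemma koszul_sqr f z : koszul f (koszul f z) = 0.
Proof.
apply/ffunP => A; rewrite koszul_koszul ffunE big1 ?oppr0 // => i _.
by rewrite big1 // => j _; rewrite (mulrC (f i)) subrr mulr0 mul0r.
Qed.

Lemma koszul_anti f g z : koszul f (koszul g z) = - koszul g (koszul f z).
Proof.
apply/ffunP => A; rewrite [RHS]ffunE !koszul_koszul opprK -sumrN.
apply: eq_bigr => i _; rewrite -sumrN; apply: eq_bigr => j _; ring.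
Qed.

(** * Exactness of the Koszul complex by successive division *)

Section Contraction.

(* Q i is an additive division by f i, with remainder x - f i * Q i x. *)
Variables (f : 'I_n -> R) (Q : 'I_n -> R -> R).
Hypothesis QB : forall i, {morph Q i : x y / x - y}.
Hypothesis QM : forall i j x, j != i -> Q i (f j * x) = f j * Q i x.
Hypothesis QK : forall i x, Q i (f i * x) = x.

Let Q0 i : Q i 0 = 0. Proof. by rewrite -[in LHS](subrr 0) QB subrr. Qed.
Let QN i x : Q i (- x) = - Q i x.
Proof. by rewrite -[- x]add0r QB Q0 add0r. Qed.
Let QD i : {morph Q i : x y / x + y}.
Proof. by move=> x y; rewrite -{1}[y]opprK QB QN opprK. Qed.
Let Q_sum i (P : pred 'I_n) F :
  Q i (\sum_(j | P j) F j) = \sum_(j | P j) Q i (F j).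
Proof. exact: (big_morph _ (@QD i) (Q0 i)). Qed.
Let Q_sign i j A x : Q i (ksign j A * x) = ksign j A * Q i x.
Proof. by rewrite /ksign -signr_odd !mulr_sign; case: ifP; rewrite ?QN. Qed.

Definition contraction i z : chain :=
  [ffun A : {set 'I_n} => if i \in A then ksign i A * Q i (z (A :\ i)) else 0].

Lemma contraction_deg i p z : chain_deg p z -> chain_deg p.+1 (contraction i z).
Proof.
move=> zp A pA; rewrite ffunE; case: ifP => // iA.
by rewrite zp ?Q0 ?mulr0 //; move: pA; rewrite (cardsD1 i A) iA.
Qed.

(** The terms at [j != i] cancel, since [Q i] commutes with [f j] and the signs are opposite; the
    term at [i] remains. *)
Lemma contraction_homotopy i z A :
  koszul f (contraction i z) A + contraction i (koszul f z) A =
  if i \in A then z A else f i * Q i (z A).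
Proof.
rewrite !ffunE; case: ifP => [iA|/negbT iA]; last first.
  rewrite addr0 (bigD1 i) //= big1 => [|j /andP[jA ji]].
    rewrite addr0 !ffunE setU11 setU1K // ksignU1 // ltnn.
    by rewrite mulrACA mulrA ksign_sqr mul1r.
  by rewrite ffunE !inE eq_sym (negbTE ji) (negbTE iA) mulr0.
set B := A :\ i.
have iB : i \notin B by rewrite !inE eqxx.
have AE : A = i |: B by rewrite setD1K.
rewrite Q_sum [X in _ + _ * X](bigD1 i) //= mulrDr.
have -> : ksign i A = ksign i B by rewrite AE ksignU1 // ltnn.
rewrite -!mulrA Q_sign QK mulrA ksign_sqr mul1r -AE addrCA.
rewrite -[RHS]addr0; congr (_ + _).
rewrite big_distrr /= [X in _ + X](eq_bigl (fun j => j \notin A)); last first.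
  by move=> j; rewrite AE in_setU1 negb_or andbC.
rewrite -big_split big1 //= => j jA.
have ij : (i == j) = false by apply: contraNF jA => /eqP <-.
have ji : j != i by rewrite eq_sym ij.
have jB : j \notin B by rewrite !inE (negbTE jA) andbF.
rewrite ffunE !inE iA orbT -!mulrA Q_sign QM //.
have -> : (j |: A) :\ i = j |: B.
  by apply/setP => l; rewrite !inE; case: (eqVneq l i) => //= ->; rewrite ij.
have lt_neq : (i < j)%N = ~~ (j < i)%N.
  by move: ji; rewrite -val_eqE /=; case: (ltngtP j i).
rewrite ksignU1 // AE ksignU1 // ksignU1 // ltnn lt_neq.
by case: (j < i)%N => /=; ring.
Qed.

(** Stand for degree bounds on a cycle and on its preimage. *)
Variables P P' : chain -> Prop.
Hypothesis P'0 : P' 0.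
Hypothesis P'D : forall z w, P' z -> P' w -> P' (z + w).
Hypothesis P_contraction : forall i z, P z -> P' (contraction i z).
Hypothesis P_rest : forall i z, P z -> P (z - koszul f (contraction i z)).

(* Contracting along each index in turn leaves a cycle supported on set0. *)
Lemma koszul_exact p z : chain_deg p.+1 z -> P z -> koszul f z = 0 ->
  exists w, [/\ chain_deg p.+2 w, P' w & z = koszul f w].
Proof.
move=> zp Pz dz.
suff H (s : seq 'I_n) : exists w z', [/\ chain_deg p.+2 w, P' w,
    [/\ chain_deg p.+1 z', P z' & koszul f z' = 0],
    z = z' + koszul f w
    & forall A i, i \in A -> i \in s -> z' A = 0].
  have [w [z' [wp Pw [z'p _ _] -> z'0]]] := H (enum 'I_n).
  exists w; split=> //; rewrite [z'](_ : _ = 0) ?add0r //.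
  apply/ffunP => A; rewrite ffunE; have [->|[i iA]] := set_0Vmem A.
    by rewrite z'p // cards0.
  by apply: z'0 iA _; rewrite mem_enum.
elim: s => [|i s [w [z' [wp Pw [z'p Pz' dz'] zE z'0]]]].
  exists 0, z; split=> //; first by move=> A _; rewrite ffunE.
  by rewrite koszul0 addr0.
have z''E A : (z' - koszul f (contraction i z')) A =
    if i \in A then 0 else z' A - f i * Q i (z' A).
  have := contraction_homotopy i z' A; rewrite dz' !ffunE.
  rewrite Q0 mulr0 if_same addr0 => ->.
  by case: ifP; rewrite ?subrr.
exists (w + contraction i z'), (z' - koszul f (contraction i z')); split.
- by move=> A pA; rewrite ffunE wp // (contraction_deg i z'p) // addr0.
- by apply: P'D => //; apply: P_contraction.
- split; last by rewrite koszulB koszul_sqr dz' subr0.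
    by move=> A pA; rewrite z''E z'p // Q0 mulr0 subrr if_same.
  exact: P_rest.
- by rewrite zE koszulD (addrC (koszul f w)) addrA subrK.
- move=> A j jA; rewrite inE z''E => /orP[/eqP <-|js]; first by rewrite jA.
  by rewrite (z'0 A j) // Q0 mulr0 subrr if_same.
Qed.

End Contraction.

(** * Truncated sequences of chains under two anticommuting differentials *)

Section Staircase.

Variables (f0 f1 : 'I_n -> R) (Wt : nat -> chain -> Prop).

Local Notation d0 := (koszul f0).
Local Notation d1 := (koszul f1).

Hypothesis exact0 : forall p z, chain_deg p.+1 z -> d0 z = 0 ->
  exists2 w, chain_deg p.+2 w & z = d0 w.
Hypothesis exact1 : forall p N z, chain_deg p.+1 z -> Wt N.+1 z -> d1 z = 0 ->
  exists w, [/\ chain_deg p.+2 w, Wt N w & z = d1 w].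
Hypothesis Wt_d0 : forall N z, Wt N z -> Wt N (d0 z).
Hypothesis Wt0 : forall z, Wt 0 z -> z = 0.
Hypothesis Wt_ex : forall z, exists N, Wt N z.

Let chain_degB p z w : chain_deg p z -> chain_deg p w -> chain_deg p (z - w).
Proof. by move=> zp wp A pA; rewrite !ffunE zp // wp // subrr. Qed.

Let chain_deg0 p : chain_deg p (0 : chain).
Proof. by move=> A _; rewrite ffunE. Qed.

Let chain_degN p z : chain_deg p z -> chain_deg p (- z).
Proof. by rewrite -[- z]sub0r; apply: chain_degB. Qed.

Let koszul_prev p z w : chain_deg p.+2 z -> chain_deg p.+3 w ->
  d0 z + d1 (d0 w) = 0 ->
  exists2 u, chain_deg p.+3 u & z = d0 u + d1 w.
Proof.
move=> zp wp zw; have [||u up uE] := @exact0 p.+1 (z - d1 w).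
- by apply: chain_degB => //; apply: koszul_deg.
- by rewrite koszulB koszul_anti opprK.
by exists u => //; rewrite -uE subrK.
Qed.

(** Write [d0 z = d1 y] with [y] of smaller weight. By anticommutation [y] satisfies the same
    hypothesis, so [y = d0 u + d1 w] by induction; then [z + d1 u] is a [d0]-cycle, hence a
    [d0]-boundary. *)
Lemma staircase_tail p z : chain_deg p.+2 z -> d1 (d0 z) = 0 ->
  exists u w, [/\ chain_deg p.+3 u, chain_deg p.+3 w & z = d0 u + d1 w].
Proof.
move=> zp dz; have [N zN] := Wt_ex z.
elim: N z zp zN dz => [|N IH] z zp zN dz.
  by exists 0, 0; split=> //; rewrite !koszul0 addr0 (Wt0 zN).
have [|||y [yp yN yE]] := @exact1 p N (d0 z) => //.
- exact: koszul_deg.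
- exact: Wt_d0.
have [|u [w [up wp uE]]] := IH _ yp yN.
  by rewrite koszul_anti -yE koszul_sqr oppr0.
have dE : d1 y = d1 (d0 u) by rewrite uE koszulD koszul_sqr addr0.
have [|||v vp vE] := @koszul_prev p z (- u) => //.
- exact: chain_degN.
- by rewrite !koszulN yE dE subrr.
by exists v, (- u); split=> //; apply: chain_degN.
Qed.

(** No relation follows the last chain; the condition on [d1 (d0 (V L))] takes its place and feeds
    [staircase_tail]. The earlier chains are solved with [koszul_prev]. *)
Lemma staircase_exact p L (V : nat -> chain) :
  (forall l, (l <= L)%N -> chain_deg p.+2 (V l)) ->
  (forall l, (l < L)%N -> d0 (V l) + d1 (V l.+1) = 0) ->
  d1 (d0 (V L)) = 0 ->
  exists W : nat -> chain,
    (forall l, chain_deg p.+3 (W l)) /\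
    (forall l, (l <= L)%N -> V l = d0 (W l) + d1 (W l.+1)).
Proof.
elim: L V => [|L IH] V Vp Vd VL.
  have [u [w [up wp VE]]] := staircase_tail (Vp 0%N (leqnn 0)) VL.
  exists (fun l => if l is 0 then u else w); split=> [[|l]|[|l]] //.
have [W [Wp WE]] :=
  IH (fun l => V l.+1) (fun l => Vp l.+1) (fun l => Vd l.+1) VL.
have [|u up uE] := koszul_prev (Vp 0%N isT) (Wp 0%N).
  by rewrite -(Vd 0%N) // WE // koszulD koszul_sqr addr0.
exists (fun l => if l is l'.+1 then W l' else u); split=> [[|l]|[|l] lL] //.
exact: WE.
Qed.

End Staircase.

End Koszul.

(** * The Eagon-Northcott complex as sequences of Koszul chains *)

Section EagonNorthcottExactness.

Variables (R : comNzRingType) (n : nat) (M : 'M[R]_(2, n)).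

Local Notation chain := {ffun {set 'I_n} -> R}.
Local Notation d0 := (koszul (M 0)).
Local Notation d1 := (koszul (M 1)).

Lemma minor2E i j : minor2 M i j = M 0 i * M 1 j - M 0 j * M 1 i.
Proof.
rewrite /minor2 (expand_det_row _ 0) big_ord_recl big_ord1 /cofactor.
rewrite !det_mx11 !mxE /= expr0 mul1r expr1 mulN1r mulrN.
by congr (_ * M _ _ - _ * M _ _); apply/val_inj.
Qed.

(** The component of [v] along [u_l], extended by zero to all subsets and all [l]; the sum has at
    most one term. *)
Definition EN_chain p (v : {ffun EN_basis n p.+1 -> R}) (l : nat) : chain :=
  [ffun A : {set 'I_n} =>
     \sum_(b : EN_basis n p.+1 | (val b.1 == A) && (b.2 == l :> nat)) v b].

Definition EN_vec p (W : nat -> chain) : {ffun EN_basis n p.+1 -> R} :=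
  [ffun b : EN_basis n p.+1 => W b.2 (val b.1)].

Lemma EN_chainE p (v : {ffun EN_basis n p.+1 -> R}) (b : EN_basis n p.+1) :
  EN_chain v b.2 (val b.1) = v b.
Proof.
by rewrite ffunE (big_pred1 b).
Qed.

Lemma EN_chain_deg p (v : {ffun EN_basis n p.+1 -> R}) l :
  chain_deg p.+2 (EN_chain v l).
Proof.
move=> A pA; rewrite ffunE big1 // => b /andP[/eqP bA _].
by case/negP: pA; rewrite -bA (valP b.1).
Qed.

Lemma EN_chain_vec p (W : nat -> chain) l :
  (l <= p)%N -> chain_deg p.+2 (W l) -> EN_chain (EN_vec p W) l = W l.
Proof.
move=> lp Wl; apply/ffunP => A; have [pA|pA] := boolP (#|A| == p.+2).
  pose b : EN_basis n p.+1 := (Sub A pA, Ordinal (lp : l < p.+1)%N).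
  by rewrite -[l]/(nat_of_ord b.2) -[A]/(val b.1) EN_chainE ffunE.
by rewrite EN_chain_deg // Wl.
Qed.

(** Contracting [u_l] with [y_0] keeps the index and with [y_1] lowers it by one, so component [l]
    of the image receives component [l] through the first row and [l + 1] through the second. *)
Lemma EN_diffE p (v : {ffun EN_basis n p.+2 -> R}) (c : EN_basis n p.+1) :
  EN_diff M p.+1 v c =
  (d0 (EN_chain v c.2) + d1 (EN_chain v c.2.+1)) (val c.1).
Proof.
rewrite !ffunE -big_split /=; set C := sval c.1.
under eq_bigr => b _ do rewrite big_distrr /=.
rewrite (exchange_big_dep (fun i => i \notin C)) /=; last first.
  by move=> b i _ /andP[_ /eqP ->]; rewrite !inE eqxx.
apply: eq_bigr => i iC.
rewrite (eq_bigl (fun b : EN_basis n p.+2 => val b.1 == i |: C)); last first.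
  move=> b; apply/andP/eqP => [[ib /eqP ->]|->]; first by rewrite setD1K.
  by rewrite setU11 setU1K.
rewrite !ffunE !big_mkcondr /=.
rewrite !big_distrr -big_split /=; apply: eq_bigr => b /eqP ->.
have -> : (-1) ^+ #|[set j in i |: C | (j < i)%N]| = ksign R i C.
  by rewrite -[LHS]/(ksign R i (i |: C)) ksignU1 // ltnn.
by do 2!case: eqP => _; rewrite ?mulr1n ?mulr0n; ring.
Qed.

Lemma EN_diff0E (v : {ffun EN_basis n 1 -> R}) :
  EN_diff M 0 v tt = d1 (d0 (EN_chain v 0)) set0.
Proof.
rewrite koszul_anti [RHS]ffunE koszul_koszul opprK ffunE /=.
under eq_bigr => b _ do rewrite big_distrr /=.
rewrite (exchange_big_dep predT) //=.
apply: eq_big => [i|i _]; first by rewrite inE.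
under eq_bigr => b _ do rewrite big_distrr /=.
rewrite (exchange_big_dep (fun j : 'I_n => (i < j)%N)) /=; last first.
  by move=> b j _ /andP[].
apply: eq_big => [j|j ij]; first by rewrite inE.
rewrite ffunE big_distrr /=; apply: eq_big => [b|b _]; last first.
  rewrite minor2E /ksign.
  do 2![rewrite (_ : [set _ in set0 | _] = set0);
          last by apply/setP => l; rewrite !inE].
  by rewrite cards0; ring.
rewrite ij andbT (ord1 b.2) andbT; apply/andP/eqP => [[ib jb]|->].
  apply/esym/eqP; rewrite eqEcard; apply/andP; split.
    by apply/subsetP => l; rewrite !inE => /or3P[/eqP->|/eqP->|].
  have := valP b.1; rewrite /= => /eqP ->.
  rewrite cardsU1 cardsU1 !inE cards0 !orbF.
  by rewrite -val_eqE /= gtn_eqF.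
by rewrite !inE !eqxx orbT.
Qed.

Lemma EN_cycleP p (v : {ffun EN_basis n p.+2 -> R}) :
  EN_diff M p.+1 v = [ffun=> 0] <->
  forall l, (l <= p)%N -> d0 (EN_chain v l) + d1 (EN_chain v l.+1) = 0.
Proof.
split=> [dv l lp|dv].
  apply/ffunP => A; rewrite [RHS]ffunE.
  have [pA|pA] := boolP (#|A| == p.+2).
    pose c : EN_basis n p.+1 := (Sub A pA, Ordinal (lp : l < p.+1)%N).
    by have := EN_diffE v c; rewrite dv ffunE => ->.
  by rewrite ffunE !(@koszul_deg _ _ _ p.+2) ?addr0 //; apply: EN_chain_deg.
by apply/ffunP => c; rewrite EN_diffE dv ?ffunE // -ltnS.
Qed.

Lemma EN_cycle0P (v : {ffun EN_basis n 1 -> R}) :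
  EN_diff M 0 v = [ffun=> 0] <-> d1 (d0 (EN_chain v 0)) = 0.
Proof.
split=> [dv|dv]; last first.
  by apply/ffunP => -[]; rewrite EN_diff0E dv !ffunE.
apply/ffunP => A; rewrite [RHS]ffunE; have [->|A0] := eqVneq A set0.
  by rewrite -EN_diff0E dv ffunE.
apply: (@koszul_deg _ _ _ 0); last by rewrite cards_eq0.
by apply: koszul_deg; apply: EN_chain_deg.
Qed.

Lemma EN_chain_diff p (w : {ffun EN_basis n p.+2 -> R}) l : (l <= p)%N ->
  EN_chain (EN_diff M p.+1 w) l =
  d0 (EN_chain w l) + d1 (EN_chain w l.+1).
Proof.
move=> lp.
have -> : EN_diff M p.+1 w =
    EN_vec p (fun l => d0 (EN_chain w l) + d1 (EN_chain w l.+1)).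
  by apply/ffunP => c; rewrite EN_diffE [RHS]ffunE.
rewrite EN_chain_vec // => A pA.
by rewrite ffunE !(@koszul_deg _ _ _ p.+2) ?addr0 //; apply: EN_chain_deg.
Qed.

Lemma EN_diff_diff p (w : {ffun EN_basis n p.+2 -> R}) :
  EN_diff M p (EN_diff M p.+1 w) = [ffun=> 0].
Proof.
case: p w => [|p] w.
  apply/EN_cycle0P; rewrite EN_chain_diff // koszulD koszul_sqr add0r.
  by rewrite koszul_anti koszul_sqr koszul0 oppr0.
apply/EN_cycleP => l lp; rewrite !EN_chain_diff ?(leqW lp) //.
by rewrite !koszulD !koszul_sqr add0r addr0 koszul_anti addNr.
Qed.

Variable Wt : nat -> chain -> Prop.
Hypothesis exact0 : forall p z, chain_deg p.+1 z -> d0 z = 0 ->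
  exists2 w, chain_deg p.+2 w & z = d0 w.
Hypothesis exact1 : forall p N z, chain_deg p.+1 z -> Wt N.+1 z -> d1 z = 0 ->
  exists w, [/\ chain_deg p.+2 w, Wt N w & z = d1 w].
Hypothesis Wt_d0 : forall N z, Wt N z -> Wt N (d0 z).
Hypothesis Wt0 : forall z, Wt 0 z -> z = 0.
Hypothesis Wt_ex : forall z, exists N, Wt N z.

Lemma EN_exact p (v : {ffun EN_basis n p.+1 -> R}) :
  EN_diff M p v = [ffun=> 0] <-> exists w, v = EN_diff M p.+1 w.
Proof.
split=> [dv|[w ->]]; last exact: EN_diff_diff.
have [|||W [Wp WE]] := @staircase_exact _ _ _ _ Wt exact0 exact1 Wt_d0 Wt0 Wt_ex
  p p (EN_chain v).
- by move=> l _; apply: EN_chain_deg.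
- by case: p v dv => // p v /EN_cycleP dv l lp; apply: dv.
(* In homological degree 1 this is the cycle condition itself; in higher degrees it follows by
   applying [d0] to the last relation. *)
- case: p v dv => [|p] v; first by move/EN_cycle0P.
  move/EN_cycleP/(_ p (leqnn p)) => dv; rewrite koszul_anti.
  have : d0 (d0 (EN_chain v p) + d1 (EN_chain v p.+1)) = 0.
    by rewrite dv koszul0.
  by rewrite koszulD koszul_sqr add0r => ->; rewrite oppr0.
exists (EN_vec p.+1 W); apply/ffunP => c.
have cp : (c.2 <= p)%N by rewrite -ltnS.
by rewrite EN_diffE !EN_chain_vec ?(leqW cp) // -WE // EN_chainE.
Qed.

End EagonNorthcottExactness.

(** * Division of polynomials by monomials *)

Section MonomialDivision.

Variables (k : fieldType) (n : nat).

Implicit Types (p : {mpoly k[n]}) (m nu : 'X_{1..n}).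

Definition mdivX nu p : {mpoly k[n]} :=
  \sum_(m <- msupp p | (nu <= m)%MM) p@_m *: 'X_[m - nu].

Lemma mcoeff_divX nu p m : (mdivX nu p)@_m = p@_(m + nu)%MM.
Proof.
rewrite /mdivX raddf_sum /=.
under eq_bigr => m' _ do rewrite mcoeffZ mcoeffX.
have [mp|mp] := boolP ((m + nu)%MM \in msupp p).
  rewrite big_mkcond (bigD1_seq (m + nu)%MM) ?msupp_uniq //= lem_addl.
  rewrite addmK eqxx mulr1 big1 ?addr0 // => m' neq; case: ifP => // num'.
  case: eqP => [mE|_]; last by rewrite mulr0.
  by case/eqP: neq; rewrite -mE submK.
rewrite (memN_msupp_eq0 mp) big_seq_cond big1 // => m' /andP[m'p num'].
case: eqP => [mE|_]; last by rewrite mulr0.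
by move: mp; rewrite -mE submK ?m'p.
Qed.

Lemma mcoeffXM nu p m :
  ('X_[nu] * p)@_m = if (nu <= m)%MM then p@_(m - nu)%MM else 0.
Proof.
rewrite mulrC; case: ifP => [num|/negP num].
  by rewrite -{1}(submK num) addmC mcoeffMX.
apply: memN_msupp_eq0; rewrite (perm_mem (msuppMX _ _)).
by apply/mapP => -[m' _ mE]; apply: num; rewrite mE lem_addr.
Qed.

Lemma mdivXB nu : {morph mdivX nu : p p' / p - p'}.
Proof.
by move=> p p'; apply/mpolyP => m; rewrite !mcoeffB !mcoeff_divX mcoeffB.
Qed.

Lemma mdivXK nu p : mdivX nu ('X_[nu] * p) = p.
Proof.
by apply/mpolyP => m; rewrite mcoeff_divX mcoeffXM lem_addl addmK.
Qed.

Lemma mdivXM nu nu' p : (forall i, nu i = 0%N \/ nu' i = 0%N) ->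
  mdivX nu ('X_[nu'] * p) = 'X_[nu'] * mdivX nu p.
Proof.
move=> disj; apply/mpolyP => m; rewrite mcoeff_divX !mcoeffXM mcoeff_divX.
have leE : (nu' <= m + nu)%MM = (nu' <= m)%MM.
  apply/mnm_lepP/mnm_lepP => le i; have := le i; rewrite mnmDE;
    by case: (disj i); lia.
rewrite leE; case: ifP => // /mnm_lepP le; congr (_@__); apply/mnmP => i.
by rewrite !(mnmDE, mnmBE); have := le i; lia.
Qed.

End MonomialDivision.

Lemma wdegD n (a : 'I_n -> nat) (m m' : 'X_{1..n}) :
  wdeg a (m + m')%MM = (wdeg a m + wdeg a m')%N.
Proof.
rewrite /wdeg -big_split; apply: eq_bigr => i _ /=.
by rewrite mnmDE mulnDl.
Qed.

Lemma wdeg_pow n (a : 'I_n -> nat) i e : wdeg a (U_(i) *+ e)%MM = (e * a i)%N.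
Proof.
rewrite /wdeg (bigD1 i) //= big1 ?addn0 => [|j ji].
  by rewrite mulmnE mnm1E eqxx mul1n.
by rewrite mulmnE mnm1E eq_sym (negbTE ji).
Qed.

(** * Weights, and Koszul complexes of powers of distinct variables *)

Section PowerKoszul.

Variables (k : fieldType) (n : nat) (a d : 'I_n -> nat).

Local Notation S := {mpoly k[n]}.
Local Notation chain := {ffun {set 'I_n} -> S}.

(** Total degrees are taken with [e_i] in degree [d i]; the bound is strict so that 0 leaves only
    the zero chain. *)
Definition weight_lt (N : nat) (z : chain) : Prop :=
  forall (A : {set 'I_n}) m, (z A)@_m != 0 ->
    (wdeg a m + \sum_(i in A) d i < N)%N.

Lemma weight_ltB N z w :
  weight_lt N z -> weight_lt N w -> weight_lt N (z - w).
Proof.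
move=> zN wN A m; rewrite !ffunE mcoeffB => zw.
have [z0|] := eqVneq (z A)@_m 0; last exact: zN.
by apply: wN; apply: contraNneq zw => ->; rewrite z0 subr0.
Qed.

Lemma weight_lt_0chain N : weight_lt N 0.
Proof. by move=> A m; rewrite ffunE mcoeff0 eqxx. Qed.

Lemma weight_ltD N z w :
  weight_lt N z -> weight_lt N w -> weight_lt N (z + w).
Proof.
move=> zN wN; rewrite -[w]opprK; apply: weight_ltB => //.
by rewrite -[- w]sub0r; apply: weight_ltB => //; apply: weight_lt_0chain.
Qed.

Lemma weight_lt0 z : weight_lt 0 z -> z = 0.
Proof.
move=> z0; apply/ffunP => A; rewrite ffunE; apply/mpolyP => m.
by rewrite mcoeff0; apply/eqP; apply: contraT => /z0.
Qed.

Lemma weight_lt_ex z : exists N, weight_lt N z.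
Proof.
exists (\max_(A : {set 'I_n})
          \max_(m <- msupp (z A)) (wdeg a m + \sum_(i in A) d i).+1)%N.
move=> A m; rewrite -mcoeff_msupp => mz.
by rewrite (bigD1 A) //= (bigD1_seq m) ?msupp_uniq //= -maxnA leq_maxl.
Qed.

Lemma weight_lt_leq N N' z : (N <= N')%N -> weight_lt N z -> weight_lt N' z.
Proof. by move=> le zN A m /zN lt; apply: leq_trans lt le. Qed.

Lemma mcoeff_ksignM (i : 'I_n) (A : {set 'I_n}) (p : S) m :
  ((ksign _ i A * p)@_m != 0) = (p@_m != 0).
Proof.
rewrite /ksign -signr_odd mulr_sign; case: ifP => // _.
by rewrite mcoeffN oppr_eq0.
Qed.

(** Covers both rows of the cyclic matrix: the first with [t] the identity and [b = 0], the second
    with [t = ordS] and [b = alpha]. *)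
Variables (t : 'I_n -> 'I_n) (e : 'I_n -> nat) (b : nat).
Hypothesis t_inj : injective t.
Hypothesis weight_te : forall i, (e i * a (t i))%N = (d i + b)%N.

Local Notation f := (fun i => 'X_(t i) ^+ e i : S).
Local Notation mu i := (U_(t i) *+ e i)%MM.
Local Notation Q := (fun i => @mdivX k n (mu i)).

Lemma weight_lt_koszul N z : weight_lt N z -> weight_lt (N + b) (koszul f z).
Proof.
move=> zN A m; rewrite ffunE raddf_sum /= => nz.
have [i iA nzi] : exists2 i, i \notin A &
    (ksign _ i A * 'X_(t i) ^+ e i * z (i |: A))@_m != 0.
  apply/exists_inP; apply: contraNT nz => /exists_inPn z0.
  by rewrite big1 // => i /z0; rewrite negbK => /eqP.
move: nzi; rewrite -mulrA mcoeff_ksignM mpolyXn mcoeffXM.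
case: ifP => [mum /zN|]; last by rewrite eqxx.
rewrite big_setU1 //= => lt; rewrite -(submK mum) wdegD wdeg_pow weight_te.
by move: lt; lia.
Qed.

Lemma weight_lt_contraction N i z :
  weight_lt (N + b) z -> weight_lt N (contraction Q i z).
Proof.
move=> zN A m; rewrite ffunE; case: ifP => [iA|]; last first.
  by rewrite mcoeff0 eqxx.
rewrite mcoeff_ksignM mcoeff_divX => /zN.
by rewrite wdegD wdeg_pow weight_te (big_setD1 i iA) /=; lia.
Qed.

(** As [t] is injective, division by one power commutes with multiplication by the others, so
    contraction applies; it lowers the weight bound by [b]. *)
Lemma koszul_powers_exact p N z :
  chain_deg p.+1 z -> weight_lt (N + b) z -> koszul f z = 0 ->
  exists w, [/\ chain_deg p.+2 w, weight_lt N w & z = koszul f w].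
Proof.
apply: (koszul_exact (Q := Q)).
- by move=> i; apply: mdivXB.
- move=> i j x ji; rewrite mpolyXn; apply: mdivXM => l.
  rewrite !mulmnE !mnm1E; have [<-|] := eqVneq (t i) l; last by left.
  by right; rewrite (inj_eq t_inj) (negbTE ji).
- by move=> i x; rewrite mpolyXn mdivXK.
- exact: weight_lt_0chain.
- exact: weight_ltD.
- exact: weight_lt_contraction.
- move=> i x xN; apply: weight_ltB => //.
  by apply: weight_lt_koszul; apply: weight_lt_contraction.
Qed.

End PowerKoszul.

(** * Generated ideals, and the ideal of minors as an image *)

Section IdealGen.

Variables (R : comNzRingType) (I : finType) (g : I -> R).

Lemma ideal_gen_mem i : ideal_gen g (g i).
Proof.
exists (fun j => (j == i)%:R); rewrite (bigD1 i) //= eqxx mul1r big1 ?addr0 //.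
by move=> j /negbTE ->; rewrite mul0r.
Qed.

Lemma ideal_gen0 : ideal_gen g 0.
Proof. by exists (fun=> 0); rewrite big1 // => i _; rewrite mul0r. Qed.

Lemma ideal_genD x y : ideal_gen g x -> ideal_gen g y -> ideal_gen g (x + y).
Proof.
move=> [c ->] [c' ->]; exists (fun i => c i + c' i).
by rewrite -big_split; apply: eq_bigr => i _; rewrite mulrDl.
Qed.

Lemma ideal_genMl x y : ideal_gen g y -> ideal_gen g (x * y).
Proof.
move=> [c ->]; exists (fun i => x * c i).
by rewrite big_distrr; apply: eq_bigr => i _; rewrite /= mulrA.
Qed.

Lemma ideal_genMr x y : ideal_gen g x -> ideal_gen g (x * y).
Proof. by rewrite mulrC; apply: ideal_genMl. Qed.

Lemma ideal_gen_sum (J : Type) (s : seq J) (P : pred J) (F : J -> R) :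
  (forall j, P j -> ideal_gen g (F j)) ->
  ideal_gen g (\sum_(j <- s | P j) F j).
Proof. exact: (big_ind _ ideal_gen0 ideal_genD). Qed.

End IdealGen.

Section MinorIdeal.

Variables (R : comNzRingType) (n : nat) (M : 'M[R]_(2, n)).

Lemma EN_diff_linear p x (v w : {ffun EN_basis n p.+1 -> R}) :
  EN_diff M p [ffun b => x * v b + w b] =
  [ffun c => x * EN_diff M p v c + EN_diff M p w c].
Proof.
apply/ffunP => c; rewrite !ffunE big_distrr -big_split /=.
by apply: eq_bigr => b _; rewrite ffunE mulrDl mulrA.
Qed.

Lemma EN_diff0_minor (i j : 'I_n) : (i < j)%N ->
  exists w : {ffun EN_basis n 1 -> R}, EN_diff M 0 w tt = minor2 M i j.
Proof.
move=> ij; pose z : {ffun {set 'I_n} -> R} := [ffun A => (A == [set i; j])%:R].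
have neq_ij : i != j by rewrite -val_eqE /= ltn_eqF.
have z2 : chain_deg 2 z.
  move=> A A2; rewrite ffunE; have [AE|//] := eqVneq A [set i; j].
  by move: A2; rewrite AE cards2 neq_ij.
exists (EN_vec 0 (fun=> z)); rewrite EN_diff0E EN_chain_vec // koszul_koszul.
rewrite -sumrN (bigD1 i) ?inE //= -sumrN (bigD1 j) ?inE //= !big1.
- rewrite !addr0 ffunE setU0 setUC eqxx mulr1 minor2E /ksign.
  have c0 l : #|[set j in (set0 : {set 'I_n}) | (j < l)%N]| = 0%N.
    by apply/eqP; rewrite cards_eq0; apply/eqP/setP => m; rewrite !inE.
  by rewrite !c0 expr0; ring.
- move=> i' i'i; rewrite big1 ?oppr0 // => j' /andP[_ i'j'].
  rewrite ffunE setU0; case: eqP => [E|]; last by rewrite mulr0.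
  have [_ neq] := andP i'i.
  have : i \in [set j'; i'] by rewrite E set21.
  have : j \in [set j'; i'] by rewrite E set22.
  rewrite !inE (eq_sym i i') (negbTE neq) orbF => jE /eqP iE.
  move: jE; rewrite -iE eq_sym (negbTE neq_ij) /= => /eqP jE.
  by move: i'j' ij; rewrite -jE -iE; case: ltngtP.
- move=> j' j'j; rewrite ffunE setU0.
  case: eqP => [E|]; last by rewrite mulr0 oppr0.
  move: j'j => /andP[/andP[_ ij'] j'j].
  have : j \in [set j'; i] by rewrite E set22.
  by rewrite !inE (eq_sym j j') (negbTE j'j) /= eq_sym (negbTE neq_ij).
Qed.

Lemma I2_EN_diff0 x :
  I2 M x <-> exists w : {ffun EN_basis n 1 -> R}, EN_diff M 0 w tt = x.
Proof.
split=> [[c ->]|[w <-]]; last first.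
  rewrite ffunE; apply: ideal_gen_sum => b _; apply: ideal_genMl.
  apply: ideal_gen_sum => i _; apply: ideal_gen_sum => j _.
  exact: (ideal_gen_mem (fun ij => minor2 M ij.1 ij.2) (i, j)).
pose im x := exists w : {ffun EN_basis n 1 -> R}, EN_diff M 0 w tt = x.
have imM y z z' : im z -> im z' -> im (y * z + z').
  move=> [w <-] [w' <-]; exists [ffun b => y * w b + w' b].
  by rewrite EN_diff_linear ffunE.
have im0 : im 0.
  by exists 0; rewrite ffunE big1 // => b _; rewrite ffunE mul0r.
apply: (big_ind im) => // [y z yP zP|[i j] _ /=].
  by rewrite -[y]mul1r; apply: imM.
rewrite -[_ * _]addr0; apply: (imM) => //.
have [ij|ji|ij] := ltngtP i j; first exact: EN_diff0_minor.
  have -> : minor2 M i j = - 1 * minor2 M j i + 0 by rewrite !minor2E; ring.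
  by apply: imM => //; apply: EN_diff0_minor.
by rewrite (val_inj ij) minor2E subrr.
Qed.

End MinorIdeal.

Lemma addmCA n (m1 m2 m3 : 'X_{1..n}) : (m1 + (m2 + m3) = m2 + (m1 + m3))%MM.
Proof. by rewrite !addmA (addmC m1). Qed.

(** * The defining ideal and the minors of the cyclic matrix *)

Section CyclicMatrix.

Variables (n : nat) (a q r : 'I_n -> nat) (alpha : nat).

Local Notation top i := (U_(i) *+ (q i).+1)%MM.
Local Notation bot i := (U_(ordS i) *+ r (ordS i))%MM.

Hypothesis rel : forall i,
  ((q i + 1) * a i + alpha = r (ordS i) * a (ordS i))%N.

Lemma wdeg_bot i : wdeg a (bot i) = (wdeg a (top i) + alpha)%N.
Proof. by rewrite !wdeg_pow -rel addn1. Qed.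

(* Generated by the exponent pairs of the minors of the cyclic matrix. *)
Inductive minor_connected : 'X_{1..n} -> 'X_{1..n} -> Prop :=
| MinorRefl u : minor_connected u u
| MinorStep i j c v : minor_connected (top j + (bot i + c))%MM v ->
    minor_connected (top i + (bot j + c))%MM v.

Lemma minor_connected_trans u v x :
  minor_connected u v -> minor_connected v x -> minor_connected u x.
Proof. by elim=> // i j c {}v _ IH /IH; apply: MinorStep. Qed.

Lemma minor_step i j c :
  minor_connected (top i + (bot j + c))%MM (top j + (bot i + c))%MM.
Proof. by apply: MinorStep; apply: MinorRefl. Qed.

(** If [k] and [l] differ, the common exponent [top k + d] is divisible by both first-row entries,
    and the two shifts differ by a single minor. *)
Lemma bot_shift_top k l d d' : (top k + d = top l + d')%MM ->
  minor_connected (bot k + d)%MM (bot l + d')%MM.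
Proof.
move=> E; have [kl|kl] := eqVneq k l.
  have -> : d = d' by apply: (@addmI _ (top k)); rewrite E kl.
  by rewrite kl; apply: MinorRefl.
have led : (top l <= d)%MM.
  apply/mnm_lepP => i; rewrite mulmnE mnm1E.
  have [<-|_] := eqVneq l i; last by rewrite mul0n.
  have /mnmP/(_ l) := E; rewrite !mnmDE !mulmnE !mnm1E eqxx (negbTE kl); lia.
have dE := submK led; set c := (d - top l)%MM in dE.
have d'E : d' = (top k + c)%MM.
  by apply: (@addmI _ (top l)); rewrite -E -dE addmA addmC.
by rewrite d'E -dE (addmC c) !(addmCA (bot _)); apply: minor_step.
Qed.

(** Both ends of a minor step can be shifted to [bot i + (bot j + c)], so a chain of steps is
    followed one by one with [bot_shift_top]. *)
Lemma minor_connected_shift u v : minor_connected u v ->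
  forall k l d d', u = (top k + d)%MM -> v = (top l + d')%MM ->
  minor_connected (bot k + d)%MM (bot l + d')%MM.
Proof.
elim=> [{}u k l d d' -> |i j c {}v _ IH k l d d' uE vE].
  exact: bot_shift_top.
apply: (@minor_connected_trans _ (bot i + (bot j + c))%MM).
  by apply: bot_shift_top; rewrite uE.
by rewrite addmCA; apply: IH.
Qed.

Variable h : nat.
Hypothesis n_gt0 : (0 < n)%N.
Hypothesis a_gt0 : forall i, (0 < a i)%N.
Hypothesis r_gt0 : forall i, (0 < r i)%N.
Hypothesis alpha_gt0 : (0 < alpha)%N.
Hypothesis hE : h = (\sum_i q i * a i)%N.
Hypothesis last_notin : forall c, wdeg a c <> (h + n.-1 * alpha)%N.
Hypothesis sub_or_dual : forall u,
  (exists c, (wdeg a c + alpha)%N = wdeg a u) \/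
  (exists v, (wdeg a u + wdeg a v)%N = (h + n * alpha)%N).

(** The largest exponent divisible by no entry of the second row. *)
Let rho := [multinom (r i).-1 | i < n].

Lemma wdeg_rho : wdeg a rho = (h + n * alpha)%N.
Proof.
have : (wdeg a rho + \sum_i a i = h + n * alpha + \sum_i a i)%N; last by lia.
rewrite /wdeg -big_split /=.
rewrite (eq_bigr (fun i => r i * a i)%N) => [|i _]; last first.
  by rewrite mnmE; have := r_gt0 i; nia.
rewrite (reindex (@ordS n)) /=; last exact: onW_bij (ordS_bij n).
under eq_bigr => i _ do rewrite -rel mulnDl mul1n.
rewrite !big_split /= sum_nat_const card_ord -hE; lia.
Qed.

Lemma not_le_rho u : ~~ (u <= rho)%MM -> exists i d, u = (bot i + d)%MM.
Proof.
move=> nle; have [j lt] : exists j, (rho j < u j)%N.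
  apply/existsP; apply: contraNT nle => /existsPn le.
  by apply/mnm_lepP => j; rewrite leqNgt.
exists (ord_pred j), (u - bot (ord_pred j))%MM.
rewrite addmC submK // ord_predK; apply/mnm_lepP => l.
rewrite mulmnE mnm1E; case: eqP => // <-.
by rewrite mul1n; move: lt; rewrite mnmE; have := r_gt0 j; lia.
Qed.

(** If [u] is not below [rho], it is divisible by a second-row entry, and exchanging that for the
    entry above it gives the excluded degree [h + (n - 1) * alpha]. *)
Lemma eq_rho_of_wdeg u : wdeg a u = wdeg a rho -> u = rho.
Proof.
move=> uE; have le : (u <= rho)%MM.
  apply: contraT => /not_le_rho[i [d dE]].
  case: (@last_notin (top i + d)%MM).
  move: uE; rewrite dE !wdegD wdeg_bot wdeg_rho.
  have -> : (n * alpha = n.-1 * alpha + alpha)%N by nia.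
  lia.
have /eqP : wdeg a (rho - u)%MM = 0%N.
  by have := wdegD a (rho - u)%MM u; rewrite submK // uE; lia.
rewrite sum_nat_eq0 => /forallP w0; apply/mnmP => i.
have /mnm_lepP/(_ i) := le; have := w0 i.
by rewrite mnmBE muln_eq0 (gtn_eqF (a_gt0 i)) orbF /=; lia.
Qed.

(** If [u] divided [rho], then [c + (rho - u)] would have the excluded degree. *)
Lemma bot_of_sub u c : (wdeg a c + alpha)%N = wdeg a u ->
  exists i d, u = (bot i + d)%MM.
Proof.
move=> cE; apply: not_le_rho; apply/negP => le.
case: (@last_notin (c + (rho - u))%MM).
have := wdegD a (rho - u)%MM u; rewrite submK // wdeg_rho wdegD -cE.
have -> : (n * alpha = n.-1 * alpha + alpha)%N by nia.
lia.
Qed.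

Lemma fiber_connected u v : wdeg a u = wdeg a v -> minor_connected u v.
Proof.
have [N] := ubnP (wdeg a u).
elim: N u v => // N IH u v uN uv; have [[c cE]|[x xE]] := sub_or_dual u.
  have [i [d uE]] := bot_of_sub cE.
  have [|j [d' vE]] := @bot_of_sub v c; first by rewrite -uv.
  move: uN uv; rewrite uE vE !wdegD !wdeg_bot => uN uv.
  apply: (@minor_connected_shift (top i + d)%MM (top j + d')%MM) => //.
  by apply: IH; rewrite !wdegD; lia.
(* The same [x] completes both [u] and [v] to degree [h + n * alpha], where [rho] is the only
   exponent. *)
have ux : (u + x)%MM = rho by apply: eq_rho_of_wdeg; rewrite wdegD wdeg_rho.
have vx : (v + x)%MM = rho by apply: eq_rho_of_wdeg; rewrite wdegD wdeg_rho -uv.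
have -> : u = v by rewrite -(addmK x u) -(addmK x v) ux vx.
exact: MinorRefl.
Qed.

Variable k : fieldType.

Local Notation S := {mpoly k[n]}.
Local Notation M := (cyclic_matrix k q r).

Lemma cyclic0E i : M 0 i = 'X_[top i].
Proof. by rewrite mxE /= mpolyXn. Qed.

Lemma cyclic1E i : M 1 i = 'X_[bot i].
Proof. by rewrite mxE /= mpolyXn. Qed.

Lemma minor_connected_I2 u v : minor_connected u v ->
  I2 M ('X_[u] - 'X_[v]).
Proof.
elim=> [{}u|i j c {}v _ IH]; first by rewrite subrr; apply: ideal_gen0.
rewrite -[X in X - _](subrK 'X_[top j + (bot i + c)]%MM) -addrA.
apply: ideal_genD IH.
rewrite !mpolyXD -[_ - _](_ : minor2 M i j * 'X_[c] = _).
  apply: ideal_genMr.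
  exact: (ideal_gen_mem (fun ij => minor2 M ij.1 ij.2) (i, j)).
by rewrite minor2E !cyclic0E !cyclic1E; ring.
Qed.

Lemma phiE (x : S) :
  phi a x = \sum_(m <- msupp x) x@_m *: 'X^(wdeg a m).
Proof.
apply: eq_bigr => m _; rewrite mul_polyC /mmap1 /wdeg; congr (_ *: _).
rewrite -prodrXr; apply: eq_bigr => i _.
by rewrite mulnC; apply/esym/exprM.
Qed.

Lemma phiX m : phi a ('X_[m] : S) = 'X^(wdeg a m).
Proof. by rewrite phiE msuppX big_seq1 mcoeffX eqxx scale1r. Qed.

Lemma phiD (x y : S) : phi a (x + y) = phi a x + phi a y.
Proof. exact: mmapD. Qed.

Lemma phiM (x y : S) : phi a (x * y) = phi a x * phi a y.
Proof. exact: rmorphM. Qed.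

Lemma phi_sum (J : Type) (s : seq J) (P : pred J) (F : J -> S) :
  phi a (\sum_(j <- s | P j) F j) = \sum_(j <- s | P j) phi a (F j).
Proof. by apply: big_morph; [exact: phiD | exact: mmap0]. Qed.

Lemma phi_minor i j : phi a (minor2 M i j) = 0.
Proof.
rewrite minor2E !cyclic0E !cyclic1E -!mpolyXD /phi mmapB.
rewrite -!/(phi a _) !phiX !wdegD !wdeg_bot.
by rewrite addnA (addnC (wdeg a (top i))) addnA subrr.
Qed.

Lemma defining_ideal_I2 (x : S) : defining_ideal a x <-> I2 M x.
Proof.
split=> [x0|[c ->]]; last first.
  rewrite /defining_ideal phi_sum big1 // => ij _.
  by rewrite phiM phi_minor mulr0.
(* One representative exponent in the support of [x] for each degree; the default 0 occurs only for
   degrees absent from the support. *)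
pose kap s := nth 0%MM (msupp x) (find (fun m => wdeg a m == s) (msupp x)).
have kapP m : m \in msupp x -> wdeg a (kap (wdeg a m)) = wdeg a m.
  move=> mx; apply/eqP; apply: (nth_find 0%MM (a := fun m' => wdeg a m' == _)).
  by apply/hasP; exists m.
rewrite [x]mpolyE.
rewrite [X in I2 M X](_ : _ = \sum_(m <- msupp x)
    x@_m *: ('X_[m] - 'X_[kap (wdeg a m)])).
  rewrite big_seq; apply: ideal_gen_sum => m mx; rewrite -mul_mpolyC.
  apply: ideal_genMl; apply: minor_connected_I2; apply: fiber_connected.
  by rewrite kapP.
under [RHS]eq_bigr => m _ do rewrite scalerBr.
rewrite sumrB -[LHS]subr0; congr (_ - _); apply/esym.
pose N := (\max_(m <- msupp x) wdeg a m).+1.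
(* Grouped by degree, the coefficient of ['X_[kap s]] is that of [t^s] in [phi a x], hence zero. *)
transitivity (\sum_(s < N) (phi a x)`_s *: ('X_[kap s] : S)); last first.
  by rewrite [phi a x]x0 big1 // => s _; rewrite coef0 scale0r.
under [RHS]eq_bigr => s _ do rewrite phiE coef_sum scaler_suml.
rewrite exchange_big /= big_seq [RHS]big_seq; apply: eq_bigr => m mx.
have ltN : (wdeg a m < N)%N by rewrite ltnS leq_bigmax_seq.
rewrite (bigD1 (Ordinal ltN)) //= big1 => [|s neq].
  by rewrite addr0 coefZ coefXn eqxx mulr1.
by rewrite coefZ coefXn -[_ == _]/(s == Ordinal ltN) (negbTE neq) mulr0 scale0r.
Qed.

End CyclicMatrix.

Lemma eq_koszul (R : comNzRingType) (n : nat) (f g : 'I_n -> R) :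
  f =1 g -> koszul f =1 koszul g.
Proof.
move=> fg z; apply/ffunP => A; rewrite !ffunE.
by apply: eq_bigr => i _; rewrite fg.
Qed.

(** * The graded minimal free resolution *)

Section Resolution.

Variables (k : fieldType) (n : nat) (a q r : 'I_n -> nat) (alpha : nat).

Hypothesis rel : forall i,
  ((q i + 1) * a i + alpha = r (ordS i) * a (ordS i))%N.
Hypothesis r_gt0 : forall i, (0 < r i)%N.
Hypothesis alpha_gt0 : (0 < alpha)%N.

Local Notation S := {mpoly k[n]}.
Local Notation M := (cyclic_matrix k q r).
Local Notation d := (fun i => (q i + 1) * a i)%N.

Lemma cyclic_EN_exact p (v : {ffun EN_basis n p.+1 -> S}) :
  EN_diff M p v = [ffun=> 0] <-> exists w, v = EN_diff M p.+1 w.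
Proof.
have k0 : koszul (M 0) =1 koszul (fun i => 'X_i ^+ (q i).+1).
  by apply: eq_koszul => i; rewrite mxE /=.
have k1 : koszul (M 1) =1 koszul (fun i => 'X_(ordS i) ^+ r (ordS i)).
  by apply: eq_koszul => i; rewrite mxE /=.
have e0 i : ((q i).+1 * a i)%N = (d i + 0)%N by rewrite addn0 addn1.
have e1 i : (r (ordS i) * a (ordS i))%N = (d i + alpha)%N by rewrite rel.
(* Weights are counted in multiples of [alpha], the amount by which solving against the second row
   lowers the bound. *)
apply: (@EN_exact _ _ _ (fun N => weight_lt a d (N * alpha))).
- move=> p' z zp; rewrite k0 => dz; have [N zN] := weight_lt_ex a d z.
  have [|w [wp _ ->]] := koszul_powers_exact (@inj_id _) e0 (N := N) zp _ dz.
    by rewrite addn0.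
  by exists w; rewrite ?k0.
- move=> p' N z zp zN; rewrite k1 => dz.
  have [|w [wp wN ->]] :=
    koszul_powers_exact (@ordS_inj n) e1 (N := (N * alpha)%N) zp _ dz.
    by rewrite addnC -mulSn.
  by exists w; rewrite k1.
- move=> N z zN; rewrite k0 -[(N * alpha)%N]addn0.
  exact: (weight_lt_koszul e0).
- by move=> z; rewrite mul0n; apply: weight_lt0.
- move=> z; have [N zN] := weight_lt_ex a d z; exists N.
  by apply: weight_lt_leq zN; rewrite leq_pmulr.
Qed.

(* The monomials of x have degree s' - s, without truncated subtraction. *)
Let hom s s' (x : S) := forall m, m \in msupp x -> (wdeg a m + s)%N = s'.

Let hom0 s s' : hom s s' 0.
Proof. by move=> m; rewrite mcoeff_msupp mcoeff0 eqxx. Qed.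

Let homD s s' x y : hom s s' x -> hom s s' y -> hom s s' (x + y).
Proof.
move=> xh yh m /msuppD_le; rewrite mem_cat => /orP[]; [exact: xh | exact: yh].
Qed.

Let hom_sum s s' (I : Type) (l : seq I) (P : pred I) (F : I -> S) :
  (forall i, P i -> hom s s' (F i)) -> hom s s' (\sum_(i <- l | P i) F i).
Proof. exact: (big_ind (hom s s') (@hom0 s s') (@homD s s')). Qed.

Let homM s s' s'' x y : hom s' s'' x -> hom s s' y -> hom s s'' (x * y).
Proof.
move=> xh yh m /msuppM_le /allpairsP[[m1 m2] /= [m1x m2y ->]].
by rewrite wdegD -addnA (yh _ m2y) (xh _ m1x).
Qed.

Let homX s s' m : (wdeg a m + s)%N = s' -> hom s s' 'X_[m].
Proof. by move=> E m' /mem_msuppXP <-. Qed.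

Let homMsign s s' e x : hom s s' x -> hom s s' ((-1) ^+ e * x).
Proof.
rewrite -signr_odd mulr_sign; case: ifP => // _ xh m.
by rewrite mcoeff_msupp mcoeffN oppr_eq0 -mcoeff_msupp; apply: xh.
Qed.

Let homN s s' x : hom s s' x -> hom s s' (- x).
Proof. by move=> xh; rewrite -mulN1r -[-1]expr1; apply: homMsign. Qed.

Let hom_M0 s i : hom s (d i + s)%N (M 0 i).
Proof. by rewrite cyclic0E; apply: homX; rewrite wdeg_pow addn1. Qed.

Let hom_M1 s i : hom s (d i + alpha + s)%N (M 1 i).
Proof. by rewrite cyclic1E; apply: homX; rewrite wdeg_pow -rel. Qed.

Lemma EN_coef_homogeneous p (b : EN_basis n p.+1) (c : EN_basis n p) :
  hom (EN_deg d alpha p c) (EN_deg d alpha p.+1 b) (EN_coef M b c).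
Proof.
case: p b c => [|p] b c.
  rewrite /= (ord1 b.2) mul1n; apply: hom_sum => i ib; apply: hom_sum => j.
  case/andP=> jb ij.
  have neq_ij : i != j by rewrite -val_eqE /= ltn_eqF.
  have bE : val b.1 = [set i; j].
    apply/esym/eqP; rewrite eqEcard (eqP (valP b.1)) cards2 neq_ij andbT.
    by apply/subsetP => l; rewrite !inE => /orP[] /eqP ->.
  rewrite [X in (X + _)%N](_ : _ = (d i + d j)%N); last first.
    by rewrite [sval b.1]bE big_setU1 ?inE //= big_set1.
  rewrite minor2E; apply: homD; last apply: homN.
    have := homM (@hom_M0 (d j + alpha + 0)%N i) (@hom_M1 0 j).
    by rewrite addn0 addnA.
  have := homM (@hom_M0 (d i + alpha + 0)%N j) (@hom_M1 0 i).
  by rewrite addn0 addnA [(d j + d i)%N]addnC.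
rewrite /=; apply: hom_sum => i /andP[ib /eqP cE].
apply: homMsign; rewrite (big_setD1 i ib) /= -cE -!addnA.
apply: homD.
  case: eqP => [->|_]; last by rewrite mulr0n.
  exact: hom_M0.
case: eqP => [->|_]; last by rewrite mulr0n.
(* The extra degree [alpha] of the second row is balanced by the index [l] dropping by one. *)
rewrite mulr1n [X in hom _ (_ + X)%N](_ : _ =
    alpha + (\sum_(j in sval c.1) d j + c.2.+1 * alpha))%N; last first.
  by rewrite [in LHS]mulSn addnCA.
by rewrite addnA; apply: hom_M1.
Qed.

Lemma EN_diff_homogeneous p e (v : {ffun EN_basis n p.+1 -> S}) :
  homogeneous a (EN_deg d alpha p.+1) e v ->
  homogeneous a (EN_deg d alpha p) e (EN_diff M p v).
Proof.
move=> vh c; rewrite ffunE; apply: hom_sum => b _.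
by apply: homM; [apply: vh | apply: EN_coef_homogeneous].
Qed.

Let max_ideal_X m : m != 0%MM -> max_ideal ('X_[m] : S).
Proof.
move=> m0; have [i mi] : exists i, m i != 0%N.
  apply/existsP; apply: contraNT m0 => /existsPn m0; apply/eqP/mnmP => i.
  by rewrite mnm0E; apply/eqP; rewrite -[_ == _]negbK m0.
rewrite -(submK (_ : (U_(i) <= m)%MM)) ?lep1mP // mpolyXD.
by apply: ideal_genMl; apply: (ideal_gen_mem (fun i => 'X_i)).
Qed.

Let pow_neq0 (i : 'I_n) e : (0 < e)%N -> (U_(i) *+ e)%MM != 0%MM.
Proof.
move=> e0; apply: contraTneq e0 => /mnmP/(_ i).
by rewrite mulmnE mnm1E eqxx mul1n mnm0E => ->.
Qed.

Lemma cyclic_max_ideal s i : max_ideal (M s i).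
Proof.
have [->|s0] := eqVneq s 0.
  by rewrite cyclic0E; apply: max_ideal_X; apply: pow_neq0.
have -> : s = 1 by case: s s0 => -[|[|//]] //= ? _; apply: val_inj.
by rewrite cyclic1E; apply: max_ideal_X; apply: pow_neq0.
Qed.

Lemma EN_diff_minimal p (v : {ffun EN_basis n p.+1 -> S}) c :
  max_ideal (EN_diff M p v c).
Proof.
rewrite ffunE; apply: ideal_gen_sum => b _; apply: ideal_genMl.
case: p v b c => [|p] v b c /=; apply: ideal_gen_sum => i _.
  apply: ideal_gen_sum => j _; rewrite minor2E -mulrN.
  apply: ideal_genD; first exact/ideal_genMr/cyclic_max_ideal.
  exact/ideal_genMr/cyclic_max_ideal.
apply: ideal_genMl; apply: ideal_genD; case: (_ == _); rewrite ?mulr0n ?mulr1n;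
  by [apply: cyclic_max_ideal | apply: ideal_gen0].
Qed.

Lemma phi_homogeneous e (x : S) :
  (forall m, m \in msupp x -> wdeg a m = e) -> exists c, phi a x = c *: 'X^e.
Proof.
move=> xh; exists (\sum_(m <- msupp x) x@_m); rewrite phiE scaler_suml.
by rewrite big_seq [RHS]big_seq; apply: eq_bigr => m /xh ->.
Qed.

Lemma semigroup_ringP f :
  semigroup_ring a f <-> exists x : S, phi a x = f.
Proof.
split=> [|[x <-]] ; last first.
  move=> P Pc PD PM PX; rewrite /phi /mmap; apply: big_ind => //.
    by rewrite -polyC0.
  move=> m _; apply: (PM) => //; rewrite /mmap1.
  apply: (big_ind P) => [||i _]; [by rewrite -polyC1 | exact: PM |].
  elim: (m i) => [|e IH]; first by rewrite expr0 -polyC1.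
  by rewrite exprS; exact: PM (PX i) IH.
move/(_ (fun y => exists x : S, phi a x = y)); apply.
- by move=> c; exists c%:MP; rewrite /phi mmapC.
- by move=> _ _ [u <-] [v <-]; exists (u + v); rewrite phiD.
- by move=> _ _ [u <-] [v <-]; exists (u * v); rewrite phiM.
- by move=> i; exists 'X_i; rewrite phiX -[U_(i)%MM]mulm1n wdeg_pow mul1n.
Qed.

Lemma cyclic_EN_resolution :
  (forall x : S, defining_ideal a x <-> I2 M x) ->
  graded_minimal_free_resolution a (EN_deg d alpha) (EN_diff M)
    (fun v => phi a (v tt)).
Proof.
move=> idE; split.
- exact: EN_diff_linear.
- by move=> x v w; rewrite ffunE phiD phiM.
- exact: EN_diff_homogeneous.
- move=> e v vh; apply: phi_homogeneous => m mv.
  by rewrite -(vh tt m mv) addn0.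
- move=> f; rewrite semigroup_ringP; split=> [[x <-]|[v <-]].
    by exists [ffun=> x]; rewrite ffunE.
  by exists (v tt).
- move=> v; rewrite -/(defining_ideal a (v tt)) idE I2_EN_diff0.
  split=> [[w wE]|[w ->]]; exists w => //.
  by apply/ffunP => -[].
- exact: cyclic_EN_exact.
- exact: EN_diff_minimal.
Qed.

End Resolution.

(** * Permuted generators and proof of the theorem *)

Lemma semigroup_wdegP (n : nat) (a : 'I_n -> nat) (s : 'S_n) (m : nat) :
  semigroup a m <-> exists c, wdeg (fun i => a (s i)) c = m.
Proof.
split=> [/semigroupE[q ->]|[c <-]].
  exists [multinom q (s i) | i < n].
  rewrite [RHS](reindex_perm s); apply: eq_bigr => i _.
  by rewrite mnmE.
apply/semigroupE; exists (fun i => c (s^-1%g i)).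
rewrite [RHS](reindex_perm s); apply: eq_bigr => i _.
by rewrite permK.
Qed.

Theorem theorem1p2 (n : nat) (a : 'I_n -> nat) (h alpha : nat)
    (q : {ffun 'I_n -> nat}) :
  (3 <= n)%N ->
  (forall i, (0 < a i)%N) ->
  numerical_semigroup (semigroup a) ->
  minimally_generating a ->
  (0 < alpha)%N ->
  (forall f : int, pseudo_frobenius (semigroup a) f <->
     exists2 j : nat, (1 <= j <= n.-1)%N & f = h%:Z + j%:Z * alpha%:Z) ->
  unique_factorization a h q ->
  exists (s : 'S_n) (r : 'I_n -> nat),
    let a' := fun i => a (s i) in
    let q' := fun i => q (s i) in
    [/\ forall i, (0 < r i)%N,
        forall i, ((q' i + 1) * a' i + alpha = r (ordS i) * a' (ordS i))%N
      & forall k : fieldType,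
          let M := cyclic_matrix k q' r in
          (forall x : {mpoly k[n]}, defining_ideal a' x <-> I2 M x) /\
          graded_minimal_free_resolution a'
            (EN_deg (fun i => (q' i + 1) * a' i)%N alpha) (EN_diff M)
            (fun v => phi a' (v tt))].
Proof.
move=> n_ge3 a_gt0 Hsg _ alpha_gt0 pf [hE h_uniq].
have n_gt0 : (0 < n)%N by apply: leq_trans n_ge3.
have notin := ap_notin pf.
have step i : exists w : 'I_n -> nat,
    ((q i + 1) * a i + alpha = \sum_l w l * a l)%N.
  apply/semigroupE; apply: (add_step_mem Hsg pf).
    apply/semigroupE; exists (fun l => (l == i) * (q i + 1))%N.
    by rewrite (bigD1 i) //= eqxx mul1n big1 ?addn0 // => l /negbTE ->.
  (* If [h - (q i + 1) * a i] were in the semigroup, [h] would have a factorization with coefficient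
     at least [q i + 1] at [i], against uniqueness. *)
  move=> y /semigroupE[c ->] E.
  have /ffunP/(_ i) : [ffun l => (l == i) * (q i + 1) + c l]%N = q.
    apply: h_uniq; rewrite /factorization -E.
    under [RHS]eq_bigr => l _ do rewrite ffunE mulnDl.
    rewrite big_split /=; congr (_ + _)%N.
    by rewrite (bigD1 i) //= eqxx mul1n big1 ?addn0 // => l /negbTE ->.
  rewrite ffunE eqxx mul1n addn1 addSn => qE.
  by have := leqnn (q i); rewrite -{1}qE ltnNge leq_addr.
have [w wE] := fin_all_exists step.
have [s sP] := successor_cycle n_gt0 a_gt0 hE notin wE.
(* The only nonzero coefficient in the relation of the predecessor of [j]. *)
pose r j := w (s (ord_pred j)) (s j).
have r_gt0 i : (0 < r i)%N by rewrite sP ord_predK.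
have rel i : ((q (s i) + 1) * a (s i) + alpha
    = r (ordS i) * a (s (ordS i)))%N.
  rewrite wE (bigD1 (s (ordS i))) //= /r ordSK big1 ?addn0 // => l l_neq.
  by have := sP i l; rewrite (negbTE l_neq) lt0n => /negbFE/eqP ->.
exists s, r; split=> // k /=.
have idE : forall x : {mpoly k[n]},
    defining_ideal (fun i => a (s i)) x <->
    I2 (cyclic_matrix k (fun i => q (s i)) r) x.
  apply: (defining_ideal_I2 rel (h := h)) => //.
  - by rewrite hE (reindex_perm s).
  - move=> c cE; apply: (notin n.-1); first by lia.
    by apply/(semigroup_wdegP _ s); exists c.
  - move=> u; have [|[y Hy yE]|[y Hy yE]] :=
      sub_step_mem Hsg pf (s := wdeg (fun i => a (s i)) u).
    + by apply/(semigroup_wdegP _ s); exists u.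
    + by have /(semigroup_wdegP _ s)[c cE] := Hy; left; exists c; rewrite cE.
    + by have /(semigroup_wdegP _ s)[c cE] := Hy; right; exists c; rewrite cE.
split=> //; exact: cyclic_EN_resolution.
Qed.
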